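(* Let $n\ge 2$ be an integer, let $b\in\mathbb{C}$, let $g_b(w)=(w^n+b)/n$, and put $\widehat b=b^{n-1}$. If $w\in\mathbb{C}$ is a periodic point for the map $g_b$, with multiplier $\mu$, then the rings $\mathbb{Z}[\mu]$, $\mathbb{Z}[w]$, $\mathbb{Z}[b]$ and $\mathbb{Z}[\widehat b]$ all have the same integral closure, i.e. $\overline{\mathbb{Z}[\mu]}=\overline{\mathbb{Z}[w]}=\overline{\mathbb{Z}[b]}=\overline{\mathbb{Z}[\widehat b]}$.
   Context: For a ring $A\subset\mathbb{C}$, the integral closure $\overline A$ denotes the ring of all complex numbers which satisfy a monic polynomial equation with coefficients in $A$ (so the closure is taken inside $\mathbb{C}$; the bar is not complex conjugation or topological closure). For $u\in\mathbb{C}$, $\mathbb{Z}[u]$ is the subring of $\mathbb{C}$ generated by $u$. If $w$ is a periodic point of $g_b$ of (exact) period $h\ge 1$, its multiplier is the derivative $\mu=(g_b^{\circ h})'(w)$, where $g_b^{\circ h}$ is the $h$-fold iterate; note $g_b'(w)=w^{n-1}$. *)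

(* Defs.v *)
From mathcomp Require Import all_boot all_order all_algebra.
From mathcomp Require Import complex.
From mathcomp Require Import all_classical all_reals all_analysis.
Import Order.TTheory GRing.Theory Num.Theory.
Import numFieldNormedType.Exports.

Set Implicit Arguments.
Unset Strict Implicit.
Unset Printing Implicit Defensive.

Local Open Scope classical_set_scope.
Local Open Scope ring_scope.

Definition adjoinZ (K : fieldType) (u : K) : set K :=
  smallest (fun S : set K => GRing.subring_closed (mem S)) [set u].

Definition integral_closure (K : fieldType) (A : set K) : set K :=
  [set x | exists p : {poly K},
    [/\ p \is monic, (forall i : nat, A p`_i) & p.[x] = 0]].

Definition g_map (K : fieldType) (n : nat) (b w : K) : K :=
  (w ^+ n + b) / n%:R.

Definition has_exact_period (T : Type) (f : T -> T) (h : nat) (w : T) : Prop :=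
  [/\ (0 < h)%N, iter h f w = w
    & forall k : nat, (0 < k < h)%N -> iter k f w <> w].

(* [R[i]^o] is [R[i]] as a normed space over itself, so this is the complex
   derivative of the [h]-th iterate. *)
Definition multiplier (R : realType) (f : R[i] -> R[i]) (h : nat) (w : R[i]) :
  R[i] := derive1 (iter h f : R[i]^o -> R[i]^o) w.

(* Main.v *)
Require Import Defs.
From mathcomp Require Import all_boot all_order all_algebra.
From mathcomp Require Import complex.
From mathcomp Require Import all_classical all_reals all_analysis.
Import Order.TTheory GRing.Theory Num.Theory.
Import numFieldNormedType.Exports.

(* Write w_j for the points of the orbit, so that n w_(j+1) = w_j^n + b, and let
   F_d be the module, over a ring A, of polynomials of degree at most d in the
   w_j. If some N satisfies w_j^N in F_(N-1) for all j, then by pigeonhole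
   F_D = F_(D+1) for large D, so F_D is a finitely generated module stable under each w_j, and the
   w_j are integral over A. This applies with
   - A = Z[b], N = n, since w_j^n = n w_(j+1) - b;
   - A = Z[w_0], N = n, since w_j^n = w_0^n + n (w_(j+1) - w_1); then
     b = n w_1 - w_0^n is integral over Z[w_0] as well;
   - A = Z[mu], N = n (n - 1) h: the w_j^n agree up to degree 1, so w_j^N agrees
     with the product of the w_i^(n (n - 1)), i.e. mu^n, up to degree N - 1. *)

Set Implicit Arguments.
Unset Strict Implicit.
Unset Printing Implicit Defensive.

Local Open Scope classical_set_scope.
Local Open Scope ring_scope.

(** * Integrality from a finite spanning family *)

Lemma integralOver_span (R : comNzRingType) (K : fieldType)
    (f : {rmorphism R -> K}) (T : finType) (v : T -> K) (t0 : T) (z : K) :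
  v t0 != 0 ->
  (forall t, exists a : T -> R, z * v t = \sum_s f (a s) * v s) ->
  integralOver f z.
Proof.
move=> vt0 /choice[a za].
(* Determinant trick: [z] is an eigenvalue of the image of [M], so the monic characteristic
   polynomial kills it. The indices are transposed because eigenvectors are rows. *)
pose M : 'M[R]_#|T| := \matrix_(i, j) a (enum_val j) (enum_val i).
exists (char_poly M); first exact: char_poly_monic.
rewrite map_char_poly -eigenvalue_root_char; apply/eigenvalueP.
exists (\row_j v (enum_val j)); last first.
  apply: contra vt0 => /eqP/rowP/(_ (enum_rank t0)).
  by rewrite !mxE enum_rankK => ->.
apply/rowP => j; rewrite !mxE za [LHS](eq_bigr (fun i : 'I_#|T| =>
  f (a (enum_val j) (enum_val i)) * v (enum_val i))); last first.
  by move=> i _; rewrite !mxE mulrC.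
by rewrite [RHS](reindex (@enum_val T predT)) //; apply/onW_bij/enum_val_bij.
Qed.

Lemma pigeonhole_count_mem (J : finType) (s : seq J) (N : nat) :
  (#|J| * N < size s)%N -> exists i, (N < count_mem i s)%N.
Proof.
have sum_count : (\sum_i count_mem i s = size s)%N.
  elim: s => [|i s IHs] /=; first by rewrite big1.
  rewrite big_split /= IHs (bigD1 i) //= eqxx big1 ?addn0 // => j.
  by rewrite eq_sym => /negbTE ->.
rewrite -sum_count => lt_s; apply/existsP; apply: contraLR lt_s.
move/existsPn => le_N; rewrite -leqNgt -sum_nat_const.
by apply: leq_sum => i _; rewrite leqNgt.
Qed.

(** * Filtration by degree in finitely many generators *)

Section Filtration.

Variables (R : comNzRingType) (K : fieldType) (f : {rmorphism R -> K}).
Variables (J : finType) (x : J -> K) (e : J).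
Hypothesis xe : x e = 1.

(* Since 1 is among the generators [x], these are the linear combinations of
   monomials of degree at most [d]. *)
Definition filt (d : nat) (y : K) : Prop :=
  exists a : d.-tuple J -> R, y = \sum_t f (a t) * \prod_(i <- t) x i.

(* Degree strictly less than [d]. *)
Definition lfilt (d : nat) (y : K) : Prop :=
  if d is d'.+1 then filt d' y else y = 0.

Lemma filt0 d : filt d 0.
Proof. by exists (fun=> 0); rewrite big1 // => t _; rewrite rmorph0 mul0r. Qed.

Lemma filtD d y z : filt d y -> filt d z -> filt d (y + z).
Proof.
move=> [a ->] [a' ->]; exists (fun t => a t + a' t).
by rewrite -big_split; apply: eq_bigr => t _; rewrite rmorphD mulrDl.
Qed.

Lemma filtZ d c y : filt d y -> filt d (f c * y).
Proof.
move=> [a ->]; exists (fun t => c * a t).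
by rewrite mulr_sumr; apply: eq_bigr => t _; rewrite rmorphM mulrA.
Qed.

Lemma filtN d y : filt d y -> filt d (- y).
Proof. by rewrite -mulN1r -(rmorphN1 f); apply: filtZ. Qed.

Lemma filt_sum d (T : finType) (F : T -> K) :
  (forall t, filt d (F t)) -> filt d (\sum_t F t).
Proof.
by move=> Fd; elim/big_rec: _ => [|t y _]; [apply: filt0 | apply: filtD].
Qed.

Lemma filt_monomial (s : seq J) : filt (size s) (\prod_(i <- s) x i).
Proof.
exists (fun t => (t == in_tuple s)%:R).
rewrite (bigD1 (in_tuple s)) //= eqxx rmorph1 mul1r [X in _ + X]big1 ?addr0 // => t.
by move=> /negbTE->; rewrite rmorph0 mul0r.
Qed.

Lemma filtM d d' y z : filt d y -> filt d' z -> filt (d + d') (y * z).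
Proof.
move=> [a ->] [a' ->]; rewrite mulr_suml; apply: filt_sum => t.
rewrite mulr_sumr; apply: filt_sum => t'; rewrite -mulrA; apply: filtZ.
rewrite mulrCA; apply: filtZ; rewrite -big_cat.
by have := filt_monomial (t ++ t'); rewrite size_cat !size_tuple.
Qed.

Lemma filt_gen i : filt 1 (x i).
Proof. by have := filt_monomial [:: i]; rewrite big_seq1. Qed.

Lemma filt_scalar c : filt 0 (f c).
Proof.
by rewrite -[f c]mulr1; have := filtZ c (filt_monomial [::]); rewrite big_nil.
Qed.

Lemma filt_mono d d' y : (d <= d')%N -> filt d y -> filt d' y.
Proof.
move=> /subnKC <-; elim: (d' - d)%N => [|k IHk]; first by rewrite addn0.
by move/IHk/filtM/(_ (filt_gen e)); rewrite xe mulr1 addn1 addnS.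
Qed.

Lemma filtX d k y : filt d y -> filt (d * k) (y ^+ k).
Proof.
move=> yd; elim: k => [|k IHk].
  by rewrite muln0 expr0 -(rmorph1 f); apply: filt_scalar.
by rewrite mulnS exprS; apply: filtM.
Qed.

Lemma filt_natr d k : filt d k%:R.
Proof.
by apply: (@filt_mono 0) => //; rewrite -(rmorph_nat f); apply: filt_scalar.
Qed.

Lemma lfiltD d y z : lfilt d y -> lfilt d z -> lfilt d (y + z).
Proof. by case: d => [-> ->|d]; [rewrite addr0 | apply: filtD]. Qed.

Lemma lfiltM d d' y z : lfilt d y -> filt d' z -> lfilt (d + d') (y * z).
Proof.
case: d => [->|d] zd; last exact: filtM.
by rewrite mul0r; case: d' zd => //= d' _; apply: filt0.
Qed.

Lemma filt_lfilt d d' y : (d < d')%N -> filt d y -> lfilt d' y.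
Proof. by case: d' => // d' ?; apply: filt_mono. Qed.

(** Equality of the classes in degree [d] of the associated graded ring. *)
Definition same_lead (d : nat) (y z : K) : Prop :=
  [/\ filt d y, filt d z & lfilt d (y - z)].

Lemma same_lead1 : same_lead 0 1 1.
Proof. by split; [exact: (filt_natr 0 1)..|rewrite /= subrr]. Qed.

Lemma same_leadM d d' y z y' z' :
  same_lead d y z -> same_lead d' y' z' -> same_lead (d + d') (y * y') (z * z').
Proof.
move=> [yd zd yzd] [yd' zd' yzd']; split; [exact: filtM..|].
have -> : y * y' - z * z' = (y - z) * y' + (y' - z') * z.
  by rewrite !mulrBl [z' * z]mulrC [y' * z]mulrC addrA subrK.
by apply: lfiltD; [|rewrite addnC]; apply: lfiltM.
Qed.

Lemma same_lead_prod d m (F G : 'I_m -> K) :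
  (forall i, same_lead d (F i) (G i)) ->
  same_lead (d * m) (\prod_i F i) (\prod_i G i).
Proof.
elim: m F G => [|m IHm] F G FG.
  by rewrite muln0 !big_ord0; apply: same_lead1.
rewrite mulnS !big_ord_recl; apply: same_leadM => //.
by apply: IHm => i; apply: FG.
Qed.

Lemma same_leadX d k y z : same_lead d y z -> same_lead (d * k) (y ^+ k) (z ^+ k).
Proof.
move=> yz; have := @same_lead_prod d k (fun=> y) (fun=> z) (fun=> yz).
by rewrite !prodr_const card_ord.
Qed.

(** With D = #|J| (N - 1), a product of D + 1 generators repeats one of them N times; trading that
    power for an element of lower degree brings the product back into degree D. So the monomials of
    degree D span a module stable under each [x j]. *)
Lemma integralOver_filt (N : nat) :
  (0 < N)%N -> (forall i, lfilt N (x i ^+ N)) -> forall j, integralOver f (x j).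
Proof.
case: N => // N _ xN j; pose D := (#|J| * N)%N.
apply: (@integralOver_span _ _ f (D.-tuple J)
  (fun t => \prod_(i <- t) x i) [tuple of nseq D e]).
  (* The tuple constant at [e] has product 1, which gives a nonzero member of the family. *)
  by rewrite big1_seq ?oner_neq0 // => i /nseqP[-> _].
move=> t; change (filt D (x j * \prod_(i <- t) x i)).
have -> : x j * \prod_(i <- t) x i = \prod_(i <- j :: t) x i by rewrite big_cons.
set s := j :: t.
have sz_s : size s = D.+1 by rewrite /= size_tuple.
have [i lt_i] := @pigeonhole_count_mem J s N ltac:(by rewrite sz_s).
rewrite (bigID (pred1 i)) /= -[X in _ * X]big_filter.
rewrite (eq_bigr (fun=> x i)); last by move=> k /eqP ->.
rewrite big_const_seq iter_mulr_1 -(subnKC lt_i) exprD -mulrA.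
have sz_s' := count_predC (pred1 i) s.
(* Here [N] is one less than the original exponent: [x i ^+ N.+1] lies in degree [N], which absorbs
   the extra factor [x j]. *)
have -> : D = (N + ((count_mem i s - N.+1) + count (predC (pred1 i)) s))%N.
  by apply: succn_inj; rewrite -sz_s -sz_s' addnA -addSn -addSn subnKC.
apply: filtM; first exact: xN.
apply: filtM; first by rewrite -[X in filt X]mul1n; apply/filtX/filt_gen.
by rewrite -size_filter; apply: filt_monomial.
Qed.

End Filtration.

(** * Integral closure of Z[u] *)

Definition evalZ (K : fieldType) (u : K) : {rmorphism {poly int} -> K} :=
  (horner_eval u \o map_poly intr : {rmorphism {poly int} -> K}).

Lemma evalZX (K : fieldType) (u : K) : evalZ u 'X = u.
Proof. by rewrite /= map_polyX /horner_eval hornerX. Qed.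

Lemma integral_evalZ (K : fieldType) (u : K) : integralOver (evalZ u) u.
Proof. by have := integral_id (evalZ u) 'X; rewrite evalZX. Qed.

(** Lets integrality over the set Z[u] be expressed by [integralOver] for a ring morphism from
    [{poly int}]. *)
Lemma adjoinZP (K : fieldType) (u : K) : adjoinZ u = range (evalZ u).
Proof.
apply/seteqP; split => [y|_ [p _ <-] S [[S1 SB SM] Su]].
- apply; split; last by move=> _ ->; exists 'X; rewrite ?evalZX.
  split=> [|_ _ /set_mem[p _ <-] /set_mem[q _ <-]
           |_ _ /set_mem[p _ <-] /set_mem[q _ <-]]; apply/mem_set.
  + by exists 1; rewrite ?rmorph1.
  + by exists (p - q); rewrite ?rmorphB.
  + by exists (p * q); rewrite ?rmorphM.
- have S0 : 0 \in S by rewrite -(subrr 1); apply: SB.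
  have SN y : y \in S -> - y \in S by rewrite -sub0r; apply: SB.
  have SD y z : y \in S -> z \in S -> y + z \in S.
    by move=> yS /SN zS; rewrite -[z]opprK; apply: SB.
  have Snat k : k%:R \in S.
    by elim: k => [|k IHk] //; rewrite -natr1; apply: SD.
  apply: set_mem; elim/poly_ind: p => [|p c IHp]; first by rewrite rmorph0.
  rewrite rmorphD rmorphM evalZX; apply: SD.
    by apply: SM => //; apply/mem_set/Su.
  rewrite /= map_polyC /horner_eval hornerC /=.
  by case: c => k; [apply: Snat | rewrite NegzE rmorphN; apply/SN/Snat].
Qed.

(** Coefficients in Z[u] are integral over it, and a root of a monic polynomial with integral
    coefficients is integral; no monic lift of [p] has to be built. *)
Lemma integral_closure_adjoinZ (K : fieldType) (u : K) :
  integral_closure (adjoinZ u) = [set z | integralOver (evalZ u) z].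
Proof.
rewrite adjoinZP; apply/seteqP; split => [z [p [mon_p Ap pz0]]|z [p mon_p pz0]].
- have /choice[a pa] : forall i, exists q, evalZ u q = p`_i.
    by move=> i; have [q _ <-] := Ap i; exists q.
  apply: (@integral_root_monic _ _ (evalZ u) z p) => //; first exact/eqP.
  by apply/integral_poly => i; rewrite -pa; apply: integral_id.
- exists (map_poly (evalZ u) p); split; first exact: monic_map.
    by move=> i; rewrite coef_map; exists p`_i.
  exact/eqP.
Qed.

(** The elements integral over Z[v] form a subring containing [u], hence Z[u] by minimality;
    transitivity of integrality concludes. *)
Lemma integral_closure_sub (K : fieldType) (u v : K) :
  integralOver (evalZ v) u ->
  integral_closure (adjoinZ u) `<=` integral_closure (adjoinZ v).
Proof.
move=> vu; rewrite (integral_closure_adjoinZ v) => z [p [mon_p Ap pz0]].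
apply: integral_root_monic mon_p _ _; first exact/eqP.
apply/integral_poly => i; apply: (Ap i); split; last by move=> _ ->.
split=> [|y y' /set_mem vy /set_mem vy'|y y' /set_mem vy /set_mem vy'];
  apply/mem_set.
- exact: integral1.
- exact: integral_sub.
- exact: integral_mul.
Qed.

Lemma integral_closure_eq (K : fieldType) (u v : K) :
  integralOver (evalZ v) u -> integralOver (evalZ u) v ->
  integral_closure (adjoinZ u) = integral_closure (adjoinZ v).
Proof. by move=> vu uv; apply/seteqP; split; apply: integral_closure_sub. Qed.

Lemma integral_exp (R K : comNzRingType) (f : {rmorphism R -> K}) (u : K) (k : nat) :
  integralOver f u -> integralOver f (u ^+ k).
Proof.
move=> fu; elim: k => [|k IHk]; first exact: integral1.
by rewrite exprS; apply: integral_mul.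
Qed.

Lemma integral_exp_root (R K : comNzRingType) (f : {rmorphism R -> K}) (u : K) (k : nat) :
  (0 < k)%N -> integralOver f (u ^+ k) -> integralOver f u.
Proof.
move=> k_gt0 fu; apply: (@integral_root_monic _ _ f u ('X^k - (u ^+ k)%:P)).
- exact: monicXnsubC.
- by rewrite rootE !hornerE subrr.
- apply/integral_poly => i; rewrite coefB coefXn coefC.
  apply: integral_sub; first exact: integral_nat.
  by case: (i == 0%N); [exact: fu | exact: (mxpoly.integral0 f)].
Qed.

(** * Integrality along a periodic orbit *)

Section Orbit.

Variables (K : fieldType) (n h : nat) (b : K) (w : nat -> K).
Hypotheses (n_gt1 : (1 < n)%N) (h_gt0 : (0 < h)%N).
Hypothesis orbit_step : forall j, n%:R * w j.+1 = w j ^+ n + b.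
Hypothesis orbit_period : forall j, w (j + h)%N = w j.

(** [None] stands for the constant 1, which pads monomials of lower degree. *)
Let x (o : option 'I_h) : K := if o is Some i then w i else 1.
Let xe : x None = 1. Proof. by []. Qed.

Lemma orbit_mod j : w j = w (j %% h).
Proof.
rewrite {1}(divn_eq j h) addnC; elim: (j %/ h)%N => [|k IHk].
  by rewrite addn0.
by rewrite mulSnr addnA orbit_period.
Qed.

Let filt_orbit (R : comNzRingType) (f : {rmorphism R -> K}) j : filt f x 1 (w j).
Proof.
by rewrite orbit_mod; apply: (filt_gen f x (Some (Ordinal (ltn_pmod j h_gt0)))).
Qed.

Let filt_orbitZ (R : comNzRingType) (f : {rmorphism R -> K}) j :
  filt f x 1 (n%:R * w j).
Proof. by rewrite -(rmorph_nat f); apply: filtZ. Qed.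

Lemma integralOver_orbit (R : comNzRingType) (f : {rmorphism R -> K}) (N : nat) :
  (0 < N)%N -> (forall j, lfilt f x N (w j ^+ N)) ->
  forall j, integralOver f (w j).
Proof.
move=> N_gt0 wN j; rewrite orbit_mod.
apply: (@integralOver_filt _ _ f _ x None xe N N_gt0 _
  (Some (Ordinal (ltn_pmod j h_gt0)))).
case=> [i|] /=; first exact: wN.
rewrite expr1n; apply: (filt_lfilt xe N_gt0).
exact: (@filt_natr _ _ f _ x None xe 0 1).
Qed.

Lemma orbit_integral_param j : integralOver (evalZ b) (w j).
Proof.
apply: (@integralOver_orbit _ _ n) => [|{}j]; first exact: ltnW.
(* Degree 1 is strictly below [n] because [n] is at least 2. *)
apply: (filt_lfilt xe n_gt1); rewrite -[w j ^+ n](addrK b) -orbit_step.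
apply: filtD => //; apply: filtN; apply: (@filt_mono _ _ _ _ _ _ xe 0) => //.
by have := filt_scalar (evalZ b) x 'X; rewrite evalZX.
Qed.

(** Subtracting two steps of the recurrence cancels [b], so the [n]-th powers agree up to degree 1
    over any base ring. *)
Lemma orbit_expB i j : w j ^+ n - w i ^+ n = n%:R * w j.+1 - n%:R * w i.+1.
Proof. by rewrite !orbit_step opprD addrACA subrr addr0. Qed.

Lemma param_integral_orbit : integralOver (evalZ (w 0)) b.
Proof.
have int_w : forall j, integralOver (evalZ (w 0)) (w j).
  apply: (@integralOver_orbit _ _ n) => [|j]; first exact: ltnW.
  apply: (filt_lfilt xe n_gt1); rewrite -[w j ^+ n](subrK (w 0 ^+ n)) orbit_expB.
  apply: filtD; first by apply: filtD => //; apply: filtN.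
  apply: (@filt_mono _ _ _ _ _ _ xe 0) => //.
  by have := filt_scalar (evalZ (w 0)) x ('X ^+ n); rewrite rmorphXn evalZX.
have -> : b = n%:R * w 1 - w 0 ^+ n by rewrite orbit_step addrC addKr.
apply: integral_sub; last exact: integral_exp.
by apply: integral_mul; [apply: integral_nat | apply: int_w].
Qed.

(** The multiplier as given by the chain rule, since g_b'(w) = w^(n-1). *)
Let mult := \prod_(j < h) w j ^+ (n - 1).

Lemma multiplier_integral : integralOver (evalZ (w 0)) mult.
Proof.
have : integralOver (evalZ b) mult.
  rewrite /mult; elim/big_rec: _ => [|j y _]; first exact: integral1.
  by apply: integral_mul; apply/integral_exp/orbit_integral_param.
have := @integral_closure_sub _ b (w 0) param_integral_orbit.
by rewrite !integral_closure_adjoinZ; apply.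
Qed.

Lemma orbit_integral_multiplier j : integralOver (evalZ mult) (w j).
Proof.
apply: (@integralOver_orbit _ _ (n * (n - 1) * h)) => [|{}j].
  by rewrite !muln_gt0 h_gt0 subn_gt0 n_gt1 ltnW.
have lead : same_lead (evalZ mult) x (n * (n - 1) * h)
    (\prod_(i < h) (w j ^+ n) ^+ (n - 1)) (\prod_(i < h) (w i ^+ n) ^+ (n - 1)).
  apply: (same_lead_prod xe) => i; apply: (same_leadX xe); split.
  - by rewrite -[X in filt _ _ X _]mul1n; apply: filtX.
  - by rewrite -[X in filt _ _ X _]mul1n; apply: filtX.
  - apply: (filt_lfilt xe n_gt1); rewrite orbit_expB.
    by apply: filtD => //; apply: filtN.
have wE : \prod_(i < h) (w j ^+ n) ^+ (n - 1) = w j ^+ (n * (n - 1) * h).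
  by rewrite prodr_const card_ord !exprM.
have multE : \prod_(i < h) (w i ^+ n) ^+ (n - 1) = mult ^+ n.
  by rewrite -prodrXl; apply: eq_bigr => i _; rewrite exprAC.
case: lead => _ _; rewrite wE multE => lead.
rewrite -[w j ^+ _](subrK (mult ^+ n)); apply: lfiltD => //.
(* Over Z[mult], [mult ^+ n] is a scalar, hence of degree 0. *)
apply: (@filt_lfilt _ _ _ _ _ _ xe 0).
  by rewrite !muln_gt0 h_gt0 subn_gt0 n_gt1 ltnW.
by have := filt_scalar (evalZ mult) x ('X ^+ n); rewrite rmorphXn evalZX.
Qed.

End Orbit.

(** * Derivative of the iterates, and the equality of closures *)

Lemma is_derive_iter_g_map (R : realType) (n : nat) (b w : R[i]) (h : nat) :
  (0 < n)%N ->
  is_derive (w : R[i]^o) 1 (iter h (g_map n b) : R[i]^o -> R[i]^o)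
    (\prod_(j < h) iter j (g_map n b) w ^+ (n - 1)).
Proof.
move=> n_gt0; have n_neq0 : n%:R != 0 :> R[i] by rewrite pnatr_eq0 -lt0n.
elim: h => [|h IHh]; first by rewrite big_ord0; apply: is_derive_id.
(* Written with operations on functions, the iterate is differentiated by instance inference. *)
have -> : iter h.+1 (g_map n b) =
    n%:R^-1 \*: ((iter h (g_map n b) : R[i]^o -> R[i]^o) ^+ n + cst b).
  by apply/funext => z; rewrite !fctE iterS [LHS]mulrC.
apply: is_derive_eq.
(* The factor [n] from the power rule cancels the denominator of the map. *)
rewrite big_ord_recr /= addr0 scalerA mulrA mulVf // mul1r subn1.
by rewrite [RHS]mulrC.
Qed.

Unset Implicit Arguments.
Set Strict Implicit.
Set Printing Implicit Defensive.

Theorem theorem1p1 (R : realType) (n : nat) (hn : (2 <= n)%N) (b w mu : R[i])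
    (h : nat) (hw : has_exact_period (g_map n b) h w)
    (hmu : mu = multiplier (g_map n b) h w) :
  [/\ integral_closure (adjoinZ mu) = integral_closure (adjoinZ w),
      integral_closure (adjoinZ w) = integral_closure (adjoinZ b)
    & integral_closure (adjoinZ b) = integral_closure (adjoinZ (b ^+ (n - 1)))].
Proof.
have [h_gt0 hw_eq _] := hw; have n_gt0 : (0 < n)%N := ltnW hn.
pose o j := iter j (g_map n b) w.
have step j : n%:R * o j.+1 = o j ^+ n + b.
  by rewrite /o iterS /g_map mulrC divfK // pnatr_eq0 -lt0n.
have per j : o (j + h)%N = o j by rewrite /o iterD hw_eq.
have {hmu}muE : mu = \prod_(j < h) o j ^+ (n - 1).
  have D := @is_derive_iter_g_map R n b w h n_gt0.
  by rewrite hmu /multiplier derive1E; apply: derive_val.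
split; apply: integral_closure_eq.
- by rewrite muE; apply: (@multiplier_integral _ n h b o).
- by rewrite muE; apply: (@orbit_integral_multiplier _ n h b o hn h_gt0 step per 0).
- exact: (@orbit_integral_param _ n h b o hn h_gt0 step per 0).
- exact: (@param_integral_orbit _ n h b o hn h_gt0 step per).
(* [b] is a root of X^(n-1) - b^(n-1), and n - 1 is positive. *)
- apply: (@integral_exp_root _ _ _ b (n - 1)); first by rewrite subn_gt0.
  exact: integral_evalZ.
- exact/integral_exp/integral_evalZ.
Qed.
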